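(* Let $A\in\mathbb{Q}_{\mathbb{R}}^{m\times n}$, $B\in\mathbb{Q}_{\mathbb{R}}^{m\times d}$, $C\in\mathbb{Q}_{\mathbb{R}}^{p\times n}$, $D\in\mathbb{Q}_{\mathbb{R}}^{p\times d}$, with $m\ge n+d$ and $C^C_c$ of full row rank. Put $\grave{P}=[A^C_c,B^C_c]\in\mathbb{C}^{2m\times(n+d)}$ and $\grave{S}=[C^C_c,D^C_c]\in\mathbb{C}^{2p\times(n+d)}$. Consider the QR factorization $$\grave{S}^H=\grave{Q}\begin{bmatrix} \grave{R} \\ 0 \end{bmatrix},\qquad \grave{Q}=[\grave{Q}_1,\grave{Q}_2],\ \grave{Q}_1\in\mathbb{C}^{(n+d)\times 2p},\ \grave{Q}_2\in\mathbb{C}^{(n+d)\times(n+d-2p)},$$ with $\grave Q$ unitary. Let the thin SVD of $\grave{P}\grave{Q}_2$ be $\grave{P}\grave{Q}_2=\grave{U}\grave{\Sigma}\grave{V}^H$, where $\grave{U}\in\mathbb{C}^{2m\times(n-2p+d)}$ and $\grave{V}\in\mathbb{C}^{(n-2p+d)\times(n-2p+d)}$ have orthonormal columns and $\grave{\Sigma}=\mathrm{diag}(\grave{\sigma}_1,\ldots,\grave{\sigma}_{n-2p+d})$ with $$\grave{\sigma}_1\ge\cdots\ge\grave{\sigma}_{n-2p}>\grave{\sigma}_{n-2p+1}\ge\cdots\ge\grave{\sigma}_{n-2p+d}>0.$$ Partition $\grave{U}=[\grave{U}_1,\grave{U}_2]$ and $\grave{V}=[\grave{V}_1,\grave{V}_2]$,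 where $\grave U_1,\grave V_1$ have $n-2p$ columns and $\grave U_2,\grave V_2$ have $d$ columns, and $\grave{\Sigma}=\mathrm{diag}(\grave{\Sigma}_1,\grave{\Sigma}_2)$ with $\grave{\Sigma}_1=\mathrm{diag}(\grave\sigma_1,\ldots,\grave\sigma_{n-2p})$, $\grave{\Sigma}_2=\mathrm{diag}(\grave\sigma_{n-2p+1},\ldots,\grave\sigma_{n-2p+d})$. Define $$\acute{V}=\grave{Q}_2\grave{V}=[\acute{V}_1,\acute{V}_2]=\begin{bmatrix} \acute{V}_{11} & \acute{V}_{12} \\ \acute{V}_{21} & \acute{V}_{22} \end{bmatrix},$$ with row blocks of sizes $n,d$ and column blocks of sizes $n-2p,d$. If $\grave{\sigma}_{n-2p}>\grave{\sigma}_{n-2p+1}$ and $\acute{V}_{22}$ is invertible, then a unique complex RBTLSE solution $X\in\mathbb{C}^{n\times d}$ for $(A,B,C,D)$ exists, and it is $$X=-\acute{V}_{12}\acute{V}_{22}^{-1}.$$ The corresponding minimizing perturbations $\bar{G}=G_1+G_2\mathbf{j}$ and $\bar{H}=H_1+H_2\mathbf{j}$ are given by $$\begin{bmatrix} G_1 \\ G_2 \end{bmatrix}=-\grave{U}_2\grave{\Sigma}_2\acute{V}_{12}^H,\qquad \begin{bmatrix} H_1 \\ H_2 \end{bmatrix}=-\grave{U}_2\grave{\Sigma}_2\acute{V}_{22}^H.$$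
   Context: $\mathbb{Q}_{\mathbb{R}}$ denotes the reduced biquaternions: the commutative real algebra with basis $1,\mathbf{i},\mathbf{j},\mathbf{k}$ and $\mathbf{j}^2=1$, $\mathbf{i}^2=\mathbf{k}^2=-1$, $\mathbf{i}\mathbf{j}=\mathbf{j}\mathbf{i}=\mathbf{k}$, $\mathbf{j}\mathbf{k}=\mathbf{k}\mathbf{j}=\mathbf{i}$, $\mathbf{k}\mathbf{i}=\mathbf{i}\mathbf{k}=-\mathbf{j}$. Identifying $\mathbb{C}=\mathbb{R}+\mathbb{R}\mathbf{i}\subset\mathbb{Q}_{\mathbb{R}}$, each $\alpha\in\mathbb{Q}_{\mathbb{R}}$ is uniquely $\beta_1+\beta_2\mathbf{j}$ with $\beta_1,\beta_2\in\mathbb{C}$, and $\|\alpha\|=\sqrt{|\beta_1|^2+|\beta_2|^2}$. For $P=(p_{ij})\in\mathbb{Q}_{\mathbb{R}}^{m\times n}$, $\|P\|_F=\sqrt{\sum_{i,j}\|p_{ij}\|^2}$. Complex matrices are regarded as reduced biquaternion matrices. $^H$ denotes conjugate transpose of a complex matrix. For $P=P_1+P_2\mathbf{j}\in\mathbb{Q}_{\mathbb{R}}^{m\times n}$ with $P_1,P_2\in\mathbb{C}^{m\times n}$, put $P^C_c=[P_1^T,P_2^T]^T\in\mathbb{C}^{2m\times n}$. Complex RBTLSE solution for $(A,B,C,D)$: consider the problem $$\min_{X,\bar{G},\bar{H}}\|[\bar{G},\bar{H}]\|_F\quad\text{subject to}\quad (A+\bar{G})X=B+\bar{H},\quad CX=D,$$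 over $X\in\mathbb{C}^{n\times d}$, $\bar{G}\in\mathbb{Q}_{\mathbb{R}}^{m\times n}$, $\bar{H}\in\mathbb{Q}_{\mathbb{R}}^{m\times d}$. A complex matrix $X$ that satisfies the constraints together with perturbations $\bar G,\bar H$ attaining the minimum is a complex RBTLSE solution, and such $\bar{G},\bar{H}$ are corresponding minimizing perturbations. *)

(* Defs.v *)
From HB Require Import structures.
From mathcomp Require Import all_boot all_order all_algebra.
From mathcomp Require Import ring complex reals.

Set Implicit Arguments.
Unset Strict Implicit.
Unset Printing Implicit Defensive.

Import Order.TTheory GRing.Theory Num.Theory.
Local Open Scope ring_scope.

(* RBQ a b c d stands for a + b i + c j + d k. *)
Record rbq (R : Type) : Type :=
  RBQ { rb_1 : R; rb_i : R; rb_j : R; rb_k : R }.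

Definition tuple_of_rbq (R : Type) (x : rbq R) : R * R * R * R :=
  (rb_1 x, rb_i x, rb_j x, rb_k x).
Definition rbq_of_tuple (R : Type) (t : R * R * R * R) : rbq R :=
  let: (a, b, c, d) := t in RBQ a b c d.

Lemma tuple_of_rbqK (R : Type) :
  cancel (@tuple_of_rbq R) (@rbq_of_tuple R).
Proof. by case. Qed.

HB.instance Definition _ (R : eqType) :=
  Equality.copy (rbq R) (can_type (@tuple_of_rbqK R)).
HB.instance Definition _ (R : choiceType) :=
  Choice.copy (rbq R) (can_type (@tuple_of_rbqK R)).

Section RbqRing.
Variable R : realType.
Implicit Types x y z : rbq R.

Definition rbq_zero : rbq R := RBQ 0 0 0 0.
Definition rbq_one : rbq R := RBQ 1 0 0 0.
Definition rbq_opp x : rbq R :=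
  RBQ (- rb_1 x) (- rb_i x) (- rb_j x) (- rb_k x).
Definition rbq_add x y : rbq R :=
  RBQ (rb_1 x + rb_1 y) (rb_i x + rb_i y) (rb_j x + rb_j y) (rb_k x + rb_k y).
Definition rbq_mul x y : rbq R :=
  RBQ (rb_1 x * rb_1 y - rb_i x * rb_i y + rb_j x * rb_j y - rb_k x * rb_k y)
      (rb_1 x * rb_i y + rb_i x * rb_1 y + rb_j x * rb_k y + rb_k x * rb_j y)
      (rb_1 x * rb_j y + rb_j x * rb_1 y - rb_i x * rb_k y - rb_k x * rb_i y)
      (rb_1 x * rb_k y + rb_k x * rb_1 y + rb_i x * rb_j y + rb_j x * rb_i y).
Definition rbq_scale (a : R) x : rbq R :=
  RBQ (a * rb_1 x) (a * rb_i x) (a * rb_j x) (a * rb_k x).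

Lemma rbq_addA : associative rbq_add.
Proof. by move=> [????] [????] [????]; congr RBQ; rewrite /= addrA. Qed.
Lemma rbq_addC : commutative rbq_add.
Proof. by move=> [????] [????]; congr RBQ; rewrite /= addrC. Qed.
Lemma rbq_add0 : left_id rbq_zero rbq_add.
Proof. by move=> [????]; congr RBQ; rewrite /= add0r. Qed.
Lemma rbq_addN : left_inverse rbq_zero rbq_opp rbq_add.
Proof. by move=> [????]; congr RBQ; rewrite /= addNr. Qed.

HB.instance Definition _ :=
  GRing.isZmodule.Build (rbq R) rbq_addA rbq_addC rbq_add0 rbq_addN.

Lemma rbq_mulA : associative rbq_mul.
Proof. by move=> [????] [????] [????]; congr RBQ => /=; ring. Qed.
Lemma rbq_mulC : commutative rbq_mul.
Proof. by move=> [????] [????]; congr RBQ => /=; ring. Qed.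
Lemma rbq_mul1 : left_id rbq_one rbq_mul.
Proof. by move=> [????]; congr RBQ => /=; ring. Qed.
Lemma rbq_mulDl : left_distributive rbq_mul rbq_add.
Proof. by move=> [????] [????] [????]; congr RBQ => /=; ring. Qed.
Lemma rbq_one_neq0 : rbq_one != 0.
Proof. by apply/eqP => -[] /eqP; rewrite oner_eq0. Qed.

HB.instance Definition _ := GRing.Zmodule_isComNzRing.Build (rbq R)
  rbq_mulA rbq_mulC rbq_mul1 rbq_mulDl rbq_one_neq0.

Lemma rbq_scaleA a b x : rbq_scale a (rbq_scale b x) = rbq_scale (a * b) x.
Proof. by congr RBQ; rewrite /= mulrA. Qed.
Lemma rbq_scale1 : left_id 1 rbq_scale.
Proof. by move=> [????]; congr RBQ; rewrite /= mul1r. Qed.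
Lemma rbq_scaleDr : right_distributive rbq_scale +%R.
Proof. by move=> a x y; congr RBQ; rewrite /= mulrDr. Qed.
Lemma rbq_scaleDl x : {morph rbq_scale^~ x : a b / a + b}.
Proof. by move=> a b; congr RBQ; rewrite /= mulrDl. Qed.

HB.instance Definition _ := GRing.Zmodule_isLmodule.Build R (rbq R)
  rbq_scaleA rbq_scale1 rbq_scaleDr rbq_scaleDl.

Lemma rbq_scaleAl (a : R) x y : a *: (x * y) = (a *: x) * y.
Proof. by congr RBQ => /=; ring. Qed.

HB.instance Definition _ :=
  GRing.Lmodule_isLalgebra.Build R (rbq R) rbq_scaleAl.
HB.instance Definition _ :=
  GRing.Lalgebra_isComAlgebra.Build R (rbq R).

Definition rbqi : rbq R := RBQ 0 1 0 0.
Definition rbqj : rbq R := RBQ 0 0 1 0.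
Definition rbqk : rbq R := RBQ 0 0 0 1.

Lemma rbq_mulii : rbqi * rbqi = -1.
Proof. by congr RBQ => /=; ring. Qed.
Lemma rbq_muljj : rbqj * rbqj = 1.
Proof. by congr RBQ => /=; ring. Qed.
Lemma rbq_mulkk : rbqk * rbqk = -1.
Proof. by congr RBQ => /=; ring. Qed.
Lemma rbq_mulij : rbqi * rbqj = rbqk.
Proof. by congr RBQ => /=; ring. Qed.
Lemma rbq_muljk : rbqj * rbqk = rbqi.
Proof. by congr RBQ => /=; ring. Qed.
Lemma rbq_mulki : rbqk * rbqi = - rbqj.
Proof. by congr RBQ => /=; ring. Qed.
Lemma rbqE (x : rbq R) :
  x = rb_1 x *: 1 + rb_i x *: rbqi + rb_j x *: rbqj + rb_k x *: rbqk.
Proof. by case: x => a b c d; congr RBQ => /=; ring. Qed.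

Definition rbq_of_complex (z : R[i]) : rbq R := RBQ (complex.Re z) (complex.Im z) 0 0.

Lemma rbq_of_complex_is_zmod_morphism : zmod_morphism rbq_of_complex.
Proof. by move=> [??] [??]; congr RBQ => /=; ring. Qed.
Lemma rbq_of_complex_is_monoid_morphism : monoid_morphism rbq_of_complex.
Proof. by split=> // -[??] [??]; congr RBQ => /=; ring. Qed.

HB.instance Definition _ :=
  GRing.isZmodMorphism.Build R[i] (rbq R) rbq_of_complex
    rbq_of_complex_is_zmod_morphism.
HB.instance Definition _ :=
  GRing.isMonoidMorphism.Build R[i] (rbq R) rbq_of_complex
    rbq_of_complex_is_monoid_morphism.

(* The components of x = beta1 x + (beta2 x) j; since k = i j, the second one
   collects the coordinates along j and k. *)
Definition beta1 (x : rbq R) : R[i] := Complex (rb_1 x) (rb_i x).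
Definition beta2 (x : rbq R) : R[i] := Complex (rb_j x) (rb_k x).

Lemma rbq_decomp (x : rbq R) :
  x = rbq_of_complex (beta1 x) + rbq_of_complex (beta2 x) * rbqj.
Proof. by case: x => a b c d; congr RBQ => /=; ring. Qed.

Lemma rbq_decomp_unique (x : rbq R) (b1 b2 : R[i]) :
  x = rbq_of_complex b1 + rbq_of_complex b2 * rbqj ->
  b1 = beta1 x /\ b2 = beta2 x.
Proof.
by move=> ->; case: b1 b2 => [a b] [c d]; split; congr Complex => /=; ring.
Qed.

Definition rbq_norm (x : rbq R) : R :=
  Num.sqrt (Normc.normc (beta1 x) ^+ 2 + Normc.normc (beta2 x) ^+ 2).

End RbqRing.

Definition normF (R : realType) (m n : nat) (P : 'M[rbq R]_(m, n)) : R :=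
  Num.sqrt (\sum_i \sum_j rbq_norm (P i j) ^+ 2).

Definition mx_of_complex (R : realType) (m n : nat) (X : 'M[R[i]]_(m, n)) :
    'M[rbq R]_(m, n) :=
  map_mx (@rbq_of_complex R) X.

(* The stacked matrix [P_1; P_2] of P = P_1 + P_2 j. *)
Definition ccol (R : realType) (m n : nat) (P : 'M[rbq R]_(m, n)) :
    'M[R[i]]_(m + m, n) :=
  col_mx (map_mx (@beta1 R) P) (map_mx (@beta2 R) P).

Definition rbtlse_feasible (R : realType) (m n d p : nat)
    (A : 'M[rbq R]_(m, n)) (B : 'M[rbq R]_(m, d))
    (C : 'M[rbq R]_(p, n)) (D : 'M[rbq R]_(p, d))
    (X : 'M[R[i]]_(n, d)) (G : 'M[rbq R]_(m, n)) (H : 'M[rbq R]_(m, d)) :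
    Prop :=
  (A + G) *m mx_of_complex X = B + H /\ C *m mx_of_complex X = D.

Definition rbtlse_minimizer (R : realType) (m n d p : nat)
    (A : 'M[rbq R]_(m, n)) (B : 'M[rbq R]_(m, d))
    (C : 'M[rbq R]_(p, n)) (D : 'M[rbq R]_(p, d))
    (X : 'M[R[i]]_(n, d)) (G : 'M[rbq R]_(m, n)) (H : 'M[rbq R]_(m, d)) :
    Prop :=
  rbtlse_feasible A B C D X G H /\
  forall (X' : 'M[R[i]]_(n, d))
         (G' : 'M[rbq R]_(m, n)) (H' : 'M[rbq R]_(m, d)),
    rbtlse_feasible A B C D X' G' H' ->
    normF (row_mx G H) <= normF (row_mx G' H').

Definition complex_rbtlse_solution (R : realType) (m n d p : nat)
    (A : 'M[rbq R]_(m, n)) (B : 'M[rbq R]_(m, d))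
    (C : 'M[rbq R]_(p, n)) (D : 'M[rbq R]_(p, d))
    (X : 'M[R[i]]_(n, d)) : Prop :=
  exists (G : 'M[rbq R]_(m, n)) (H : 'M[rbq R]_(m, d)),
    rbtlse_minimizer A B C D X G H.

Definition upper_triangular (R : realType) (n : nat) (M : 'M[R[i]]_n) : Prop :=
  forall i j : 'I_n, (j < i)%N -> M i j = 0.

Definition cdiag (R : realType) (n : nat) (s : 'rV[R]_n) : 'M[R[i]]_n :=
  diag_mx (map_mx (real_complex R) s).

(* Main.v *)
(* Write K = [G^c, H^c] and Y = [X; -I], so that the constraints read
   (P + K) Y = 0 and S Y = 0, and the objective is the Frobenius norm of K.
   Full row rank makes the triangular factor invertible, hence S Y = 0 means
   Y = Q_2 Z with Z of full column rank d.  Then P Q_2 + K Q_2 kills the range of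
   Z.  If W is the orthogonal projection onto the range of V^H Z, then
   |K|^2 >= |K Q_2|^2 >= |Sigma W|^2 = sum_i sigma_i^2 W_ii.  The numbers W_ii lie
   in [0, 1] and add up to d, so this is at least the sum of the d smallest
   sigma_i^2.  In case of equality the gap forces W = diag(0, I), so that the
   range of Y is that of Q_2 V_2, and K is determined: K Q_1 = 0 and
   K Q_2 = - U_2 Sigma_2 V_2^H. *)
Require Import Defs.
From mathcomp Require Import all_boot all_order all_algebra.
From mathcomp Require Import ring complex reals.

Set Implicit Arguments.
Unset Strict Implicit.
Unset Printing Implicit Defensive.

Import Order.TTheory GRing.Theory Num.Theory.
Local Open Scope sesquilinear_scope.
Local Open Scope ring_scope.

(** * Algebra of the conjugate transpose *)

Lemma trmxCM (C : numClosedFieldType) m n p (A : 'M[C]_(m, n))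
    (B : 'M[C]_(n, p)) : (A *m B)^t* = B^t* *m A^t*.
Proof. by rewrite trmx_mul map_mxM. Qed.

Lemma trmxC_row (C : numClosedFieldType) m n1 n2 (A : 'M[C]_(m, n1))
    (B : 'M[C]_(m, n2)) : (row_mx A B)^t* = col_mx (A^t*) (B^t*).
Proof. by rewrite tr_row_mx map_col_mx. Qed.

Lemma trmxC_col (C : numClosedFieldType) m1 m2 n (A : 'M[C]_(m1, n))
    (B : 'M[C]_(m2, n)) : (col_mx A B)^t* = row_mx (A^t*) (B^t*).
Proof. by rewrite tr_col_mx map_row_mx. Qed.

Lemma trmxC_sub (C : numClosedFieldType) m n (A B : 'M[C]_(m, n)) :
  (A - B)^t* = A^t* - B^t*.
Proof. by rewrite linearB map_mxB. Qed.

Lemma trmxC_opp (C : numClosedFieldType) m n (A : 'M[C]_(m, n)) :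
  (- A)^t* = - A^t*.
Proof. by rewrite linearN map_mxN. Qed.

Lemma trmxC1 (C : numClosedFieldType) n : (1%:M : 'M[C]_n)^t* = 1%:M.
Proof. by rewrite trmx1 map_mx1. Qed.

Lemma trmxC_diag (C : numClosedFieldType) n (s : 'rV[C]_n) :
  (forall i, s 0 i \is Num.real) -> (diag_mx s)^t* = diag_mx s.
Proof.
move=> sR; apply/matrixP=> i j; rewrite !mxE rmorphMn /= conj_Creal //.
by rewrite eq_sym; case: eqP => [->|].
Qed.

(** * The squared Frobenius norm of a complex matrix *)

(** The trace form turns norms of products into matrix algebra without square roots. Values stay in
    [C] and are compared in its partial order. *)
Definition sqnormF (C : numClosedFieldType) m n (M : 'M[C]_(m, n)) : C :=
  \tr (M *m M^t*).

Lemma sqnormFE (C : numClosedFieldType) m n (M : 'M[C]_(m, n)) :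
  sqnormF M = \sum_i \sum_j `|M i j| ^+ 2.
Proof.
apply: eq_bigr => i _; rewrite mxE; apply: eq_bigr => j _.
by rewrite !mxE normCK.
Qed.

Lemma sqnormF_ge0 (C : numClosedFieldType) m n (M : 'M[C]_(m, n)) :
  0 <= sqnormF M.
Proof. by rewrite sqnormFE; do 2!apply: sumr_ge0 => ? _; exact: exprn_ge0. Qed.

Lemma sqnormF_eq0 (C : numClosedFieldType) m n (M : 'M[C]_(m, n)) :
  sqnormF M = 0 -> M = 0.
Proof.
rewrite sqnormFE => M0; apply/matrixP=> i j; rewrite mxE; apply/eqP.
rewrite -normr_eq0 -sqrf_eq0; apply/eqP.
have ge0 i' : 0 <= \sum_j `|M i' j| ^+ 2.
  by apply: sumr_ge0 => ? _; exact: exprn_ge0.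
have r0 : \sum_j `|M i j| ^+ 2 = 0 by apply: (psumr_eq0P _ M0).
by apply: (psumr_eq0P _ r0) => // ? _; exact: exprn_ge0.
Qed.

Lemma sqnormF_trmxC (C : numClosedFieldType) m n (M : 'M[C]_(m, n)) :
  sqnormF (M^t*) = sqnormF M.
Proof.
rewrite !sqnormFE exchange_big; apply: eq_bigr => i _; apply: eq_bigr => j _.
by rewrite !mxE norm_conjC.
Qed.

(** Pythagoras for the rows of [E]. The hypothesis covers both two complementary column blocks of a
    unitary matrix and two complementary orthogonal projections. *)
Lemma sqnormF_split (C : numClosedFieldType) m n k1 k2
    (E : 'M[C]_(m, n)) (L : 'M[C]_(n, k1)) (N : 'M[C]_(n, k2)) :
  L *m L^t* + N *m N^t* = 1%:M ->
  sqnormF E = sqnormF (E *m L) + sqnormF (E *m N).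
Proof.
move=> LN; rewrite /sqnormF -linearD /= !trmxCM !mulmxA.
by rewrite -mulmxDl -[E *m L *m _]mulmxA -[E *m N *m _]mulmxA -mulmxDr LN mulmx1.
Qed.

(** * Gram matrices and orthogonal projections *)

Lemma gram_unit (C : numClosedFieldType) m n (Z : 'M[C]_(m, n)) :
  (forall v : 'cV[C]_n, Z *m v = 0 -> v = 0) -> Z^t* *m Z \in unitmx.
Proof.
move=> Z0; rewrite -row_free_unit; apply/inj_row_free => v vZ.
have v0 : v^t* = 0.
  apply: Z0; apply: sqnormF_eq0; rewrite -sqnormF_trmxC /sqnormF trmxCK.
  by rewrite trmxCM trmxCK mulmxA -[v *m _ *m _]mulmxA vZ mul0mx linear0.
by rewrite -[v]trmxCK v0 trmx0 map_mx0.
Qed.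

Definition orth_proj (C : numClosedFieldType) n (P : 'M[C]_n) :=
  P^t* = P /\ P *m P = P.

Lemma orth_proj_compl (C : numClosedFieldType) n (P : 'M[C]_n) :
  orth_proj P -> orth_proj (1%:M - P).
Proof.
move=> [Ph Pi]; split; first by rewrite trmxC_sub trmxC1 Ph.
by rewrite mulmxBl !mulmxBr !mul1mx mulmx1 Pi subrr subr0.
Qed.

(** Since [P = P *m P^t*], a diagonal entry is the squared norm of its row; a zero on the diagonal
    therefore kills the whole row. *)
Lemma orth_proj_diag (C : numClosedFieldType) n (P : 'M[C]_n) i :
  orth_proj P -> P i i = \sum_j `|P i j| ^+ 2.
Proof.
move=> [Ph Pi]; rewrite -{1}Pi mxE; apply: eq_bigr => j _.
by rewrite -{2}Ph !mxE normCK.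
Qed.

Lemma orth_proj_diag_ge0 (C : numClosedFieldType) n (P : 'M[C]_n) i :
  orth_proj P -> 0 <= P i i.
Proof.
by move/orth_proj_diag->; apply: sumr_ge0 => j _; exact: exprn_ge0.
Qed.

Lemma orth_proj_row0 (C : numClosedFieldType) n (P : 'M[C]_n) i j :
  orth_proj P -> P i i = 0 -> P i j = 0.
Proof.
move=> hP; rewrite (orth_proj_diag _ hP) => P0.
apply/eqP; rewrite -normr_eq0 -sqrf_eq0; apply/eqP.
by apply: (psumr_eq0P _ P0) => // ? _; exact: exprn_ge0.
Qed.

(* The diagonal entries of [P] lie in [0, 1] and add up to [d], so the weighted
   trace is least when all of the mass sits on the [d] smallest weights. *)
Lemma orth_proj_weighted_trace (C : numClosedFieldType) k d
    (P : 'M[C]_(k + d)) (t : 'rV[C]_(k + d)) (c : C) :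
  orth_proj P -> \tr P = d%:R ->
  (forall i : 'I_k, c < t 0 (lshift d i)) ->
  (forall j : 'I_d, t 0 (rshift k j) <= c) ->
  \sum_(j < d) t 0 (rshift k j) <= \sum_i t 0 i * P i i /\
  (\sum_i t 0 i * P i i <= \sum_(j < d) t 0 (rshift k j) ->
   P = block_mx 0 0 0 1%:M).
Proof.
move=> hP trP ct tc; have hQ := orth_proj_compl hP.
pose l := @lshift k d; pose r := @rshift k d.
(* [a] weighs the mass of [P] on the first [k] coordinates and [b] the mass missing from the last
   [d], both relative to the threshold [c]. Both are nonnegative, and by [mass] the terms in [c]
   cancel, so [a + b] is the excess over the claimed minimum. *)
pose a := \sum_(i < k) (t 0 (l i) - c) * P (l i) (l i).
pose b := \sum_(j < d) (c - t 0 (r j)) * (1 - P (r j) (r j)).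
have Q1 j : 1 - P (r j) (r j) = (1%:M - P) (r j) (r j) by rewrite !mxE eqxx.
have a_ge0 i : true -> 0 <= (t 0 (l i) - c) * P (l i) (l i).
  by rewrite mulr_ge0 ?orth_proj_diag_ge0 // subr_ge0 ltW.
have b_ge0 j : true -> 0 <= (c - t 0 (r j)) * (1 - P (r j) (r j)).
  by rewrite mulr_ge0 ?subr_ge0 // -subr_ge0 Q1 orth_proj_diag_ge0.
have mass : \sum_(i < k) P (l i) (l i) = \sum_(j < d) (1 - P (r j) (r j)).
  apply/eqP; rewrite sumrB sumr_const card_ord -trP /mxtrace big_split_ord /=.
  by rewrite addrK.
have defect : \sum_i t 0 i * P i i = \sum_(j < d) t 0 (r j) + (a + b).
  have -> : a = \sum_(i < k) t 0 (l i) * P (l i) (l i)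
                - c * \sum_(i < k) P (l i) (l i).
    by rewrite mulr_sumr -sumrB; apply: eq_bigr => i _; rewrite mulrBl.
  have -> : b = c * \sum_(j < d) (1 - P (r j) (r j))
                + (\sum_(j < d) t 0 (r j) * P (r j) (r j)
                   - \sum_(j < d) t 0 (r j)).
    rewrite -sumrB mulr_sumr -big_split; apply: eq_bigr => j _ /=.
    by rewrite mulrBl [t _ _ * (1 - _)]mulrBr mulr1 opprB.
  by rewrite mass big_split_ord /= -/l -/r; ring.
have ab_ge0 : 0 <= a + b by rewrite addr_ge0 ?sumr_ge0.
rewrite defect lerDl; split=> //.
rewrite gerDl => ab_le0.
have a0 : a = 0.
  apply/eqP; rewrite eq_le sumr_ge0 // andbT (le_trans _ ab_le0) //.
  by rewrite lerDl sumr_ge0.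
have Pl0 i : P (l i) (l i) = 0.
  have /eqP : (t 0 (l i) - c) * P (l i) (l i) = 0 by apply: (psumr_eq0P _ a0).
  by rewrite mulf_eq0 gt_eqF ?subr_gt0 //= => /eqP.
(* The weights in the last block may equal [c], so [b = 0] would not suffice here; the trace
   identity [mass] carries over the zeros found by the strict gap. *)
have Qr0 j : (1%:M - P) (r j) (r j) = 0.
  rewrite -Q1; move: (esym mass); rewrite (eq_bigr _ (fun i _ => Pl0 i)).
  rewrite big1_eq => m0; apply: (psumr_eq0P _ m0) => // j' _.
  by rewrite Q1 orth_proj_diag_ge0.
apply/matrixP=> i j; case: (split_ordP i) => i' ->.
  rewrite (orth_proj_row0 _ hP (Pl0 i')).
  by case: (split_ordP j) => j' ->; rewrite (block_mxEul, block_mxEur) mxE.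
have -> : P (r i') j = (1%:M : 'M[C]_(k + d)) (r i') j.
  by apply/eqP; rewrite eq_sym -subr_eq0 -(orth_proj_row0 j hQ (Qr0 i')) !mxE.
rewrite mxE; case: (split_ordP j) => j' ->.
  by rewrite block_mxEdl mxE eq_sym eq_lrshift.
by rewrite block_mxEdr mxE eq_rshift.
Qed.

(** The orthogonal projection onto the column space of [Z], provided that its Gram matrix is
    invertible. *)
Definition range_proj (C : numClosedFieldType) m n (Z : 'M[C]_(m, n)) : 'M_m :=
  Z *m invmx (Z^t* *m Z) *m Z^t*.

Lemma orth_proj_range (C : numClosedFieldType) m n (Z : 'M[C]_(m, n)) :
  Z^t* *m Z \in unitmx -> orth_proj (range_proj Z).
Proof.
move=> Zu; split; last first.
  by rewrite /range_proj !mulmxA -[_ *m Z^t* *m Z]mulmxA mulmxKV.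
rewrite /range_proj !trmxCM trmxCK mulmxA; congr (_ *m _ *m _).
by rewrite trmx_inv map_invmx trmxCM trmxCK.
Qed.

Lemma mxtrace_range_proj (C : numClosedFieldType) m n (Z : 'M[C]_(m, n)) :
  Z^t* *m Z \in unitmx -> \tr (range_proj Z) = n%:R.
Proof. by move=> Zu; rewrite mxtrace_mulC mulmxA mulmxV // mxtrace1. Qed.

Lemma range_projK (C : numClosedFieldType) m n (Z : 'M[C]_(m, n)) :
  Z^t* *m Z \in unitmx -> range_proj Z *m Z = Z.
Proof. by move=> Zu; rewrite /range_proj -mulmxA mulmxKV. Qed.

(** * Invariance of the Frobenius norm and the perturbation bounds *)

(** The hypothesis is orthonormality of the rows of [V], which may be rectangular: the final norm
    computation takes for [V] the conjugate transpose of a tall isometry. *)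
Lemma sqnormF_mul_unitary (C : numClosedFieldType) m n k
    (E : 'M[C]_(m, n)) (V : 'M[C]_(n, k)) :
  V *m V^t* = 1%:M -> sqnormF (E *m V) = sqnormF E.
Proof.
by move=> VV; rewrite /sqnormF trmxCM mulmxA -(mulmxA E) VV mulmx1.
Qed.

Lemma sqnormF_opp (C : numClosedFieldType) m n (E : 'M[C]_(m, n)) :
  sqnormF (- E) = sqnormF E.
Proof. by rewrite /sqnormF trmxC_opp mulNmx mulmxN opprK. Qed.

Lemma sqnormF_isometry_mul (C : numClosedFieldType) m n k
    (U : 'M[C]_(m, n)) (E : 'M[C]_(n, k)) :
  U^t* *m U = 1%:M -> sqnormF (U *m E) = sqnormF E.
Proof.
move=> UU; rewrite -sqnormF_trmxC trmxCM sqnormF_mul_unitary ?sqnormF_trmxC //.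
by rewrite trmxCK.
Qed.

Lemma sqnormF_diag (C : numClosedFieldType) n (s : 'rV[C]_n) :
  (forall i, s 0 i \is Num.real) ->
  sqnormF (diag_mx s) = \sum_i s 0 i ^+ 2.
Proof.
move=> sR; rewrite /sqnormF trmxC_diag //; apply: eq_bigr => i _.
by rewrite mul_diag_mx !mxE eqxx mulr1n.
Qed.

Lemma sqnormF_diag_proj (C : numClosedFieldType) n (s : 'rV[C]_n) (P : 'M_n) :
  (forall i, s 0 i \is Num.real) -> orth_proj P ->
  sqnormF (diag_mx s *m P) = \sum_i s 0 i ^+ 2 * P i i.
Proof.
move=> sR [Ph Pi]; rewrite /sqnormF trmxCM Ph trmxC_diag // mulmxA.
rewrite -[_ *m P *m P]mulmxA Pi; apply: eq_bigr => i _.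
by rewrite mul_mx_diag mul_diag_mx !mxE; ring.
Qed.

(* Eckart-Young with uniqueness: [Z] having full column rank [d], the matrix
   [M + E] has nullity at least [d]. *)
Lemma nullity_perturbation (C : numClosedFieldType) l k d
    (U1 : 'M[C]_(l, k)) (U2 : 'M[C]_(l, d))
    (V1 : 'M[C]_(k + d, k)) (V2 : 'M[C]_(k + d, d))
    (s1 : 'rV[C]_k) (s2 : 'rV[C]_d) (c : C)
    (E : 'M[C]_(l, k + d)) (Z : 'M[C]_(k + d, d)) :
  let U := row_mx U1 U2 in let V := row_mx V1 V2 in
  U^t* *m U = 1%:M -> V^t* *m V = 1%:M ->
  (forall i, row_mx s1 s2 0 i \is Num.real) ->
  (forall i, c < s1 0 i ^+ 2) -> (forall j, s2 0 j ^+ 2 <= c) ->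
  Z^t* *m Z \in unitmx ->
  (U *m diag_mx (row_mx s1 s2) *m V^t* + E) *m Z = 0 ->
  \sum_j s2 0 j ^+ 2 <= sqnormF E /\
  (sqnormF E <= \sum_j s2 0 j ^+ 2 ->
   E = - (U2 *m diag_mx s2 *m V2^t*) /\ Z = V2 *m (V2^t* *m Z)).
Proof.
move=> U V UU VV sR cs1 s2c Zu MEZ; have VV' := mulmx1C VV.
set S := diag_mx _ in MEZ.
(* Coordinates along the right singular vectors: with [Z = V *m W], the equation [MEZ] prescribes
   [F] on the range of [W], which is [FP] below. *)
pose W := V^t* *m Z; pose P := range_proj W; pose F := E *m V.
have Wu : W^t* *m W \in unitmx.
  by rewrite /W trmxCM trmxCK mulmxA -[_ *m V *m _]mulmxA VV' mulmx1.
have hP : orth_proj P := orth_proj_range Wu.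
have FP : F *m P = - (U *m S *m P).
  rewrite /P /range_proj !mulmxA -!mulNmx; congr (_ *m _ *m _).
  rewrite /F -[E *m V *m _]mulmxA VV' mulmx1 !mulNmx.
  by apply/eqP; rewrite -addr_eq0 addrC -mulmxDl MEZ.
(* Pythagoras along [P]: the first part of [F] is dictated by [FP] and costs a weighted trace, while
   the second is free. *)
have normE : sqnormF E = \sum_i row_mx s1 s2 0 i ^+ 2 * P i i
                         + sqnormF (F *m (1%:M - P)).
  rewrite -(sqnormF_mul_unitary E VV') (@sqnormF_split _ _ _ _ _ _ P (1%:M - P)).
    by rewrite -/F FP sqnormF_opp -mulmxA sqnormF_isometry_mul // sqnormF_diag_proj.
  have [-> ->] := hP; have [-> ->] := orth_proj_compl hP.
  by rewrite addrC subrK.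
pose t : 'rV[C]_(k + d) := \row_i row_mx s1 s2 0 i ^+ 2.
have tl (i : 'I_k) : t 0 (lshift d i) = s1 0 i ^+ 2 by rewrite mxE row_mxEl.
have tr (j : 'I_d) : t 0 (rshift k j) = s2 0 j ^+ 2 by rewrite mxE row_mxEr.
have := @orth_proj_weighted_trace _ _ _ P t c hP (mxtrace_range_proj Wu).
under [X in _ <= X]eq_bigr => i _ do rewrite mxE.
under [X in X <= _]eq_bigr => j _ do rewrite tr.
under [X in X <= _ -> _]eq_bigr => i _ do rewrite mxE.
under [X in _ <= X -> _]eq_bigr => j _ do rewrite tr.
case=> [i|j|le_tr tr_eq]; rewrite ?tl ?tr //.
rewrite normE; split; first by rewrite ler_wpDr ?sqnormF_ge0.
move=> leE.
have Pb : P = block_mx 0 0 0 1%:M.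
  by apply: tr_eq; apply: le_trans leE; rewrite lerDl sqnormF_ge0.
have F0 : F *m (1%:M - P) = 0.
  apply/sqnormF_eq0/eqP; rewrite eq_le sqnormF_ge0 andbT.
  by rewrite -(lerD2l (\sum_i row_mx s1 s2 0 i ^+ 2 * P i i)) addr0 (le_trans leE).
have PV : P *m V^t* = col_mx 0 (V2^t*).
  by rewrite Pb /V trmxC_row mul_block_col !mul0mx !mul1mx !add0r.
split.
  have -> : E = F *m V^t* by rewrite /F -mulmxA VV' mulmx1.
  have -> : F = F *m P by apply/eqP; rewrite -subr_eq0 -{1}[F]mulmx1 -mulmxBr F0.
  rewrite FP mulNmx -[U *m S *m P *m _]mulmxA PV /S diag_mx_row /U mul_row_block mul_row_col.
  by rewrite !mulmx0 !add0r.
(* [P] fixes [W], so [V *m P *m V^t*] fixes [Z]; by [PV] this product is [V2 *m V2^t*]. *)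
have VPZ : V *m P *m V^t* *m Z = Z.
  rewrite -mulmxA -/W -[V *m P *m W]mulmxA (range_projK Wu : P *m W = W).
  by rewrite /W mulmxA VV' mul1mx.
by rewrite -{1}VPZ -[V *m P *m _]mulmxA PV /V mul_row_col mulmx0 add0r -mulmxA.
Qed.

(** The constraint on [Q1] confines [Y] to the range of [Q2], so only [K *m Q2] helps to annihilate
    [Y]. The bound on it is [nullity_perturbation], and [K *m Q1] can only add to the norm, hence
    vanishes at the minimum. *)
Lemma constrained_tls (C : numClosedFieldType) l N r k d
    (Pm K : 'M[C]_(l, N)) (Q1 : 'M[C]_(N, r)) (Q2 : 'M[C]_(N, k + d))
    (U1 : 'M[C]_(l, k)) (U2 : 'M[C]_(l, d))
    (V1 : 'M[C]_(k + d, k)) (V2 : 'M[C]_(k + d, d))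
    (s1 : 'rV[C]_k) (s2 : 'rV[C]_d) (c : C) (Y : 'M[C]_(N, d)) :
  let Q := row_mx Q1 Q2 in let U := row_mx U1 U2 in let V := row_mx V1 V2 in
  Q^t* *m Q = 1%:M -> Q *m Q^t* = 1%:M ->
  U^t* *m U = 1%:M -> V^t* *m V = 1%:M ->
  Pm *m Q2 = U *m diag_mx (row_mx s1 s2) *m V^t* ->
  (forall i, row_mx s1 s2 0 i \is Num.real) ->
  (forall i, c < s1 0 i ^+ 2) -> (forall j, s2 0 j ^+ 2 <= c) ->
  Y^t* *m Y \in unitmx -> Q1^t* *m Y = 0 -> (Pm + K) *m Y = 0 ->
  \sum_j s2 0 j ^+ 2 <= sqnormF K /\
  (sqnormF K <= \sum_j s2 0 j ^+ 2 ->
   K = - (U2 *m diag_mx s2 *m (Q2 *m V2)^t*) /\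
   exists F, Y = Q2 *m V2 *m F).
Proof.
move=> Q U V QQ QQ' UU VV PQ sR cs1 s2c Yu QY PKY.
have Q12 : Q1 *m Q1^t* + Q2 *m Q2^t* = 1%:M.
  by rewrite -QQ' /Q trmxC_row mul_row_col.
have YE : Y = Q2 *m (Q2^t* *m Y).
  by rewrite -{1}[Y]mul1mx -Q12 mulmxDl -!mulmxA QY mulmx0 add0r.
pose Z := Q2^t* *m Y.
have Zu : Z^t* *m Z \in unitmx.
  (* The Gram matrix is unchanged because [Q2 *m Q2^t*] fixes [Y]. *)
  suff -> : Z^t* *m Z = Y^t* *m Y by [].
  by rewrite {1}/Z trmxCM trmxCK -mulmxA -YE.
have EZ : (U *m diag_mx (row_mx s1 s2) *m V^t* + K *m Q2) *m Z = 0.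
  by rewrite -PQ -mulmxDl -mulmxA -YE.
have [le_s2 eq_s2] := nullity_perturbation UU VV sR cs1 s2c Zu EZ.
have normK : sqnormF K = sqnormF (K *m Q1) + sqnormF (K *m Q2).
  exact: sqnormF_split.
rewrite normK; split; first by rewrite ler_wpDl ?sqnormF_ge0.
move=> leK; have [|KQ2 ZE] := eq_s2.
  by apply: le_trans leK; rewrite lerDr sqnormF_ge0.
have KQ1 : K *m Q1 = 0.
  apply/sqnormF_eq0/eqP; rewrite eq_le sqnormF_ge0 andbT.
  by rewrite -(lerD2r (sqnormF (K *m Q2))) add0r (le_trans leK).
split; last by exists (V2^t* *m Z); rewrite -mulmxA -ZE -YE.
rewrite -[K]mulmx1 -Q12 mulmxDr !mulmxA KQ1 mul0mx add0r KQ2.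
by rewrite mulNmx trmxCM !mulmxA.
Qed.

(** * From reduced biquaternion matrices to stacked complex ones *)

Lemma ccolD (R : realType) m n (P P' : 'M[rbq R]_(m, n)) :
  ccol (P + P') = ccol P + ccol P'.
Proof.
rewrite /ccol add_col_mx; congr col_mx; apply/matrixP=> i j; rewrite !mxE;
  by case: (P i j) (P' i j) => [????] [????].
Qed.

Lemma ccol_row (R : realType) m n1 n2
    (P : 'M[rbq R]_(m, n1)) (P' : 'M[rbq R]_(m, n2)) :
  ccol (row_mx P P') = row_mx (ccol P) (ccol P').
Proof. by rewrite /ccol !map_row_mx -block_mxEv block_mxEh. Qed.

Lemma ccol_inj (R : realType) m n : injective (@ccol R m n).
Proof.
move=> P P' /eq_col_mx[/matrixP e1 /matrixP e2]; apply/matrixP=> i j.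
rewrite (rbq_decomp (P i j)) (rbq_decomp (P' i j)).
by have := e1 i j; have := e2 i j; rewrite !mxE => -> ->.
Qed.

(** Lifts the optimal complex perturbations back to reduced biquaternion ones. *)
Lemma ccol_surj (R : realType) m n (M : 'M[R[i]]_(m + m, n)) :
  exists P, ccol P = M.
Proof.
exists (\matrix_(i, j)
  RBQ (complex.Re (usubmx M i j)) (complex.Im (usubmx M i j))
      (complex.Re (dsubmx M i j)) (complex.Im (dsubmx M i j))).
rewrite /ccol -[RHS]vsubmxK; congr col_mx; apply/matrixP=> i j;
  by rewrite !mxE /beta1 /beta2 /=; case: (M _ _).
Qed.

(** For complex [X], multiplication respects the two components: (P1 + P2 j) X = P1 X + (P2 X) j. *)
Lemma ccol_mul_complex (R : realType) m n d (P : 'M[rbq R]_(m, n))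
    (X : 'M[R[i]]_(n, d)) :
  ccol (P *m mx_of_complex X) = ccol P *m X.
Proof.
have sum1 (I : finType) (F : I -> rbq R) : beta1 (\sum_i F i) = \sum_i beta1 (F i).
  by apply: (big_morph _ (id1 := 0) (op1 := +%R)) => // -[????] [????].
have sum2 (I : finType) (F : I -> rbq R) : beta2 (\sum_i F i) = \sum_i beta2 (F i).
  by apply: (big_morph _ (id1 := 0) (op1 := +%R)) => // -[????] [????].
rewrite /ccol mul_col_mx; congr col_mx; apply/matrixP=> i j; rewrite !mxE.
  rewrite sum1; apply: eq_bigr => h _; rewrite !mxE.
  by case: (P i h) (X h j) => [????] [??]; congr Complex => /=; ring.
rewrite sum2; apply: eq_bigr => h _; rewrite !mxE.
by case: (P i h) (X h j) => [????] [??]; congr Complex => /=; ring.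
Qed.

Lemma sqr_normF (R : realType) m n (P : 'M[rbq R]_(m, n)) :
  (normF P ^+ 2)%:C%C = sqnormF (ccol P).
Proof.
have normcE (z : R[i]) : (Normc.normc z ^+ 2)%:C%C = `|z| ^+ 2.
  by rewrite rmorphXn; case: z.
rewrite /normF sqr_sqrtr; last by do 2!apply: sumr_ge0 => ? _; exact: sqr_ge0.
rewrite sqnormFE big_split_ord /= -big_split rmorph_sum /=.
apply: eq_bigr => i _; rewrite rmorph_sum -big_split; apply: eq_bigr => j _ /=.
rewrite col_mxEu col_mxEd !mxE /rbq_norm sqr_sqrtr ?addr_ge0 ?sqr_ge0 //.
by rewrite rmorphD; congr (_ + _); exact: normcE.
Qed.

Lemma le_normF (R : realType) m n m' n' (P : 'M[rbq R]_(m, n))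
    (P' : 'M[rbq R]_(m', n')) :
  (normF P <= normF P') = (sqnormF (ccol P) <= sqnormF (ccol P')).
Proof. by rewrite -!sqr_normF lecR ler_sqr ?nnegrE ?sqrtr_ge0. Qed.

Lemma rbtlse_feasible_ccol (R : realType) (m n d p : nat)
    (A : 'M[rbq R]_(m, n)) (B : 'M[rbq R]_(m, d))
    (C : 'M[rbq R]_(p, n)) (D : 'M[rbq R]_(p, d))
    (X : 'M[R[i]]_(n, d)) (G : 'M[rbq R]_(m, n)) (H : 'M[rbq R]_(m, d)) :
  let Y := col_mx X (- 1%:M) in
  rbtlse_feasible A B C D X G H <->
  (row_mx (ccol A) (ccol B) + row_mx (ccol G) (ccol H)) *m Y = 0 /\
  row_mx (ccol C) (ccol D) *m Y = 0.
Proof.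
have eqE q (M : 'M[rbq R]_(q, n)) (M' : 'M[rbq R]_(q, d)) :
    M *m mx_of_complex X = M' <->
    row_mx (ccol M) (ccol M') *m col_mx X (- 1%:M) = 0.
  rewrite mul_row_col mulmxN mulmx1 -ccol_mul_complex; split=> [->|/eqP].
    exact: subrr.
  by rewrite subr_eq0 => /eqP/ccol_inj.
by rewrite /= add_row_mx -!ccolD /rbtlse_feasible !eqE.
Qed.

(** * Consequences of the spectral gap and of full row rank *)

(** The threshold is the square of the first entry of [s2]; the gap is given only between the two
    adjacent indices, and sorting propagates it. For [d = 0] there is no such entry, and positivity
    allows 0. *)
Lemma singular_gap (R : realType) k d (s1 : 'rV[R]_k) (s2 : 'rV[R]_d) :
  (forall i j : 'I_(k + d), (i <= j)%N ->
     row_mx s1 s2 0 j <= row_mx s1 s2 0 i) ->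
  (forall i j : 'I_(k + d), i.+1 = k -> j = k :> nat ->
     row_mx s1 s2 0 j < row_mx s1 s2 0 i) ->
  (forall i : 'I_(k + d), 0 < row_mx s1 s2 0 i) ->
  exists c : R, (forall i, c < s1 0 i ^+ 2) /\ (forall j, s2 0 j ^+ 2 <= c).
Proof.
move=> sort gap pos.
have pos1 i : 0 < s1 0 i by have := pos (lshift d i); rewrite row_mxEl.
have pos2 j : 0 < s2 0 j by have := pos (rshift k j); rewrite row_mxEr.
case: d s2 sort gap pos pos2 => [|d] s2 sort gap pos pos2.
  by exists 0; split=> [i|[]//]; rewrite exprn_gt0.
exists (s2 0 0 ^+ 2); split=> [i|j]; last first.
  rewrite ler_sqr ?nnegrE ?(ltW (pos2 _)) //.
  by have := sort (rshift k 0) (rshift k j); rewrite !row_mxEr /= leq_add2l; apply.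
rewrite ltr_sqr ?nnegrE ?(ltW (pos1 _)) ?(ltW (pos2 _)) //.
have k_gt0 : (0 < k)%N := leq_ltn_trans (leq0n i) (ltn_ord i).
have lk : (k.-1 < k)%N by rewrite prednK.
pose l := Ordinal lk.
apply: (@lt_le_trans _ _ (s1 0 l)).
  have := gap (lshift d.+1 l) (rshift k 0).
  by rewrite row_mxEl row_mxEr /= prednK // addn0; apply.
have := sort (lshift d.+1 i) (lshift d.+1 l).
by rewrite !row_mxEl /= -ltnS prednK //; apply.
Qed.

Lemma gram_col_mx_unit (C : numClosedFieldType) n d (X : 'M[C]_(n, d)) :
  let Y := col_mx X (- 1%:M) in Y^t* *m Y \in unitmx.
Proof.
apply: gram_unit => v; rewrite mul_col_mx -col_mx0 => /eq_col_mx[_].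
by rewrite mulNmx mul1mx => /eqP; rewrite oppr_eq0 => /eqP.
Qed.

Lemma cdiag_row (R : realType) k d (s1 : 'rV[R]_k) (s2 : 'rV[R]_d) :
  cdiag (row_mx s1 s2) =
  diag_mx (row_mx (map_mx (real_complex R) s1) (map_mx (real_complex R) s2)).
Proof. by rewrite /cdiag map_row_mx. Qed.

(** [M] is [T^t*] times the left block of [Q^t*], so its full row rank [r] bounds the rank of [T^t*]
    from below. *)
Lemma trmxC_triangular_factor_unit (C : numClosedFieldType) r n d
    (M : 'M[C]_(r, n)) (M' : 'M[C]_(r, d)) (Q : 'M[C]_(n + d, r)) (T : 'M[C]_r) :
  row_free M -> (row_mx M M')^t* = Q *m T -> T^t* \in unitmx.
Proof.
move=> Mfree; move/(congr1 (fun N => N^t*)); rewrite trmxCK trmxCM.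
rewrite -[Q^t*]hsubmxK mul_mx_row => /eq_row_mx[ME _].
rewrite -row_free_unit /row_free eqn_leq rank_leq_row /=.
apply: leq_trans (mxrankM_maxl _ (lsubmx (Q^t*))).
by rewrite -ME (eqP Mfree).
Qed.

(** [hC] forces [p + p <= n], so the truncated difference [n - (p + p)] is the true one. *)
Theorem theorem4p2 (R : realType) (m n d p : nat)
  (A : 'M[rbq R]_(m, n)) (B : 'M[rbq R]_(m, d))
  (C : 'M[rbq R]_(p, n)) (D : 'M[rbq R]_(p, d))
  (hm : (n + d <= m)%N) (hC : row_free (ccol C))
  (* QR factorization of S^H *)
  (Q1 : 'M[R[i]]_(n + d, p + p))
  (Q2 : 'M[R[i]]_(n + d, n - (p + p) + d))
  (T : 'M[R[i]]_(p + p))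
  (hQl : (row_mx Q1 Q2)^t* *m row_mx Q1 Q2 = 1%:M)
  (hQr : row_mx Q1 Q2 *m (row_mx Q1 Q2)^t* = 1%:M)
  (hT : upper_triangular T)
  (hQR : (row_mx (ccol C) (ccol D))^t* = row_mx Q1 Q2 *m col_mx T 0)
  (* thin SVD of P Q_2 *)
  (U1 : 'M[R[i]]_(m + m, n - (p + p))) (U2 : 'M[R[i]]_(m + m, d))
  (V1 : 'M[R[i]]_(n - (p + p) + d, n - (p + p)))
  (V2 : 'M[R[i]]_(n - (p + p) + d, d))
  (s1 : 'rV[R]_(n - (p + p))) (s2 : 'rV[R]_d)
  (hU : (row_mx U1 U2)^t* *m row_mx U1 U2 = 1%:M)
  (hV : (row_mx V1 V2)^t* *m row_mx V1 V2 = 1%:M)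
  (hSVD : row_mx (ccol A) (ccol B) *m Q2 =
          row_mx U1 U2 *m cdiag (row_mx s1 s2) *m (row_mx V1 V2)^t*)
  (hsort : forall i j : 'I_(n - (p + p) + d), (i <= j)%N ->
             row_mx s1 s2 0 j <= row_mx s1 s2 0 i)
  (hgap : forall i j : 'I_(n - (p + p) + d),
            i.+1 = (n - (p + p))%N -> j = (n - (p + p))%N :> nat ->
            row_mx s1 s2 0 j < row_mx s1 s2 0 i)
  (hpos : forall i : 'I_(n - (p + p) + d), 0 < row_mx s1 s2 0 i) :
  let Vac : 'M[R[i]]_(n + d, n - (p + p) + d) := Q2 *m row_mx V1 V2 in
  let V12 : 'M[R[i]]_(n, d) := ursubmx Vac in
  let V22 : 'M[R[i]]_d := drsubmx Vac in
  V22 \in unitmx ->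
  unique (complex_rbtlse_solution A B C D) (- (V12 *m invmx V22)) /\
  forall (G : 'M[rbq R]_(m, n)) (H : 'M[rbq R]_(m, d)),
    rbtlse_minimizer A B C D (- (V12 *m invmx V22)) G H <->
    ccol G = - (U2 *m cdiag s2 *m V12^t*) /\
    ccol H = - (U2 *m cdiag s2 *m V22^t*).
Proof.
move=> Vac V12 V22 V22u.
have QV2 : Q2 *m V2 = col_mx V12 V22.
  rewrite /V12 /V22 /Vac mul_mx_row -[Q2 *m V1]vsubmxK -[Q2 *m V2]vsubmxK.
  by rewrite -block_mxEh block_mxKur block_mxKdr.
have QT : row_mx Q1 Q2 *m col_mx T 0 = Q1 *m T.
  by rewrite mul_row_col mulmx0 addr0.
rewrite QT in hQR.
have Tu := trmxC_triangular_factor_unit hC hQR.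
have SE : row_mx (ccol C) (ccol D) = T^t* *m Q1^t*.
  by rewrite -trmxCM -hQR trmxCK.
have [QQ12 QQ22] : Q1^t* *m Q2 = 0 /\ Q2^t* *m Q2 = 1%:M.
  by move: hQl; rewrite trmxC_row mul_col_row scalar_mx_block => /eq_block_mx[].
have UU22 : U2^t* *m U2 = 1%:M.
  by move: hU; rewrite trmxC_row mul_col_row scalar_mx_block => /eq_block_mx[].
have [VV12 VV22] : V1^t* *m V2 = 0 /\ V2^t* *m V2 = 1%:M.
  by move: hV; rewrite trmxC_row mul_col_row scalar_mx_block => /eq_block_mx[].
have QV2_isometry : (Q2 *m V2)^t* *m (Q2 *m V2) = 1%:M.
  by rewrite trmxCM mulmxA -[_ *m Q2]mulmxA QQ22 mulmx1.
have PQV2 : row_mx (ccol A) (ccol B) *m (Q2 *m V2) = U2 *m cdiag s2.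
  rewrite mulmxA hSVD -mulmxA trmxC_row mul_col_mx VV12 VV22 cdiag_row.
  rewrite diag_mx_row -mulmxA mul_block_col mul_row_col.
  by rewrite !mul0mx !mulmx0 mulmx1 !add0r mulmx0 add0r.
set X0 := - (V12 *m invmx V22).
set G0 := - (U2 *m _ *m _); set H0 := - (U2 *m _ *m _).
pose s2C := map_mx (real_complex R) s2.
have [c [cs1 s2c]] := singular_gap hsort hgap hpos.
have sR i : row_mx (map_mx (real_complex R) s1) s2C 0 i \is Num.real.
  by rewrite -map_row_mx mxE; apply/complex_realP; eexists.
have cs1C i : c%:C%C < map_mx (real_complex R) s1 0 i ^+ 2.
  by rewrite mxE -rmorphXn ltcR.
have s2cC j : s2C 0 j ^+ 2 <= c%:C%C by rewrite mxE -rmorphXn lecR.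
have K0E : row_mx G0 H0 = - (U2 *m cdiag s2 *m (Q2 *m V2)^t*).
  by rewrite QV2 trmxC_col mul_mx_row opp_row_mx.
(* One statement gives both optimality and uniqueness: every feasible triple costs at least the tail
   sum, and attaining it determines all three matrices. *)
have bound X G H : rbtlse_feasible A B C D X G H ->
    \sum_j s2C 0 j ^+ 2 <= sqnormF (row_mx (ccol G) (ccol H)) /\
    (sqnormF (row_mx (ccol G) (ccol H)) <= \sum_j s2C 0 j ^+ 2 ->
     [/\ X = X0, ccol G = G0 & ccol H = H0]).
  case/rbtlse_feasible_ccol=> PKY; rewrite SE -mulmxA => SY.
  have QY : Q1^t* *m col_mx X (- 1%:M) = 0.
    by rewrite -[LHS](mulKmx Tu) SY mulmx0.
  rewrite cdiag_row in hSVD.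
  have [] := constrained_tls hQl hQr hU hV hSVD sR cs1C s2cC
    (gram_col_mx_unit X) QY PKY.
  move=> le_s2 eq_s2; split=> // /eq_s2[KE [F]].
  rewrite QV2 mul_col_mx => /eq_col_mx[XE V22F].
  (* The lower block of [Y] is minus the identity, which fixes the change of basis [F]. *)
  have FE : F = - invmx V22.
    by rewrite -[F](mulKmx V22u) -V22F mulmxN mulmx1.
  have /eq_row_mx[-> ->] : row_mx (ccol G) (ccol H) = row_mx G0 H0.
    by rewrite KE K0E.
  by rewrite XE FE mulmxN.
have feas0 G H : ccol G = G0 -> ccol H = H0 -> rbtlse_feasible A B C D X0 G H.
  move=> GE HE; apply/rbtlse_feasible_ccol; rewrite GE HE K0E.
  (* The columns of [Y] for [X0] are combinations of those of [Q2 *m V2], so it suffices to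
     annihilate the latter; there the data give [U2 *m cdiag s2] and the perturbation gives its
     opposite. *)
  have -> : col_mx X0 (- 1%:M) = - (Q2 *m V2 *m invmx V22).
    by rewrite QV2 mul_col_mx mulmxV // opp_col_mx.
  split; last by rewrite SE mulmxN !mulmxA -[_ *m _ *m Q2]mulmxA QQ12 mulmx0 !mul0mx oppr0.
  rewrite mulmxN mulmxA mulmxDl PQV2 mulNmx -[_ *m _ *m (Q2 *m V2)]mulmxA.
  by rewrite QV2_isometry mulmx1 subrr mul0mx oppr0.
have norm0 : sqnormF (row_mx G0 H0) = \sum_j s2C 0 j ^+ 2.
  rewrite K0E sqnormF_opp sqnormF_mul_unitary; last first.
    by rewrite trmxCK.
  rewrite sqnormF_isometry_mul // sqnormF_diag // => i.
  by rewrite mxE; apply/complex_realP; eexists.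
have min0 G H : ccol G = G0 -> ccol H = H0 -> rbtlse_minimizer A B C D X0 G H.
  move=> GE HE; split; first exact: feas0.
  move=> X' G' H' /bound[le0 _].
  by rewrite le_normF !ccol_row GE HE norm0.
have [G1 G1E] := ccol_surj G0; have [H1 H1E] := ccol_surj H0.
have min_unique X G H : rbtlse_minimizer A B C D X G H ->
    [/\ X = X0, ccol G = G0 & ccol H = H0].
  (* Comparison with the explicit feasible pair [G1], [H1] shows that any minimizer attains the
     bound. *)
  case=> feas min; apply: (bound X G H feas).2.
  have := min _ _ _ (feas0 G1 H1 G1E H1E).
  by rewrite le_normF !ccol_row G1E H1E norm0.
split; last first.
  by move=> G H; split=> [/min_unique[_ -> ->]|[]]; [|exact: min0].
split; first by exists G1, H1; exact: min0.
by move=> X' [G [H /min_unique[->]]].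
Qed.
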